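(* Let $T$ be a set and let $\theta:\mathcal{F}(T)\to[0,\infty)$ be the ECF of a simple max-stable process on $T$. Set $\eta:=\theta-1$ and let $g:[0,\infty)\to[0,\infty)$ be a Bernstein function. Then for all $A,B,C\in\mathcal{F}(T)\setminus\{\varnothing\}$ $$g(\eta(A\cup B))\ \le\ g(\eta(C))+g(\eta(A\cup B))\ \le\ g(\eta(A\cup C))+g(\eta(C\cup B)).$$
   Context: $\mathcal{F}(T)$ is the set of finite subsets of $T$. Simple max-stable process: a process $X=\{X_t\}_{t\in T}$ with $\mathbb{P}(X_t\le x)=e^{-1/x}$ for all $t\in T$, $x>0$, such that for every $n\in\mathbb{N}$ and independent copies $X^{(1)},\dots,X^{(n)}$ of $X$ the process $\{\bigvee_{i=1}^nX^{(i)}_t\}_{t\in T}$ has the same law (finite-dimensional distributions) as $\{nX_t\}_{t\in T}$. Extremal coefficient function (ECF) of a simple max-stable process $X$: $\theta:\mathcal{F}(T)\to[0,\infty)$ with $\theta(\varnothing)=0$ and $\theta(A)=-x\log\mathbb{P}(\bigvee_{t\in A}X_t\le x)$ for non-empty finite $A\subset T$ (independent of $x>0$). One has $\theta(A)\in[1,|A|]$ for non-empty $A$, so $\eta\ge0$ on non-empty sets. Bernstein function: a function $g:[0,\infty)\to[0,\infty)$ satisfying one of the following equivalent conditions: (1) $g(r)=c+br+\int_{(0,\infty)}(1-e^{-\lambda r})\,\nu(\mathrm{d}\lambda)$ with $c,b\ge0$ and $\nu$ a positive Radon measure on $(0,\infty)$ with $\int_{(0,\infty)}\frac{\lambda}{1+\lambda}\nu(\mathrm{d}\lambda)<\infty$;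 (2) $g$ is continuous, $g\in C^\infty((0,\infty))$, $g\ge0$ and $(-1)^ng^{(n+1)}\ge0$ on $(0,\infty)$ for all $n\ge0$. *)

(* Defs.v *)
From HB Require Import structures.
From mathcomp Require Import all_boot all_order all_algebra finmap.
From mathcomp Require Import all_classical all_reals all_analysis.

Set Implicit Arguments.
Unset Strict Implicit.
Unset Printing Implicit Defensive.

Import Order.TTheory GRing.Theory Num.Theory.
Import numFieldNormedType.Exports.

Local Open Scope classical_set_scope.
Local Open Scope ring_scope.

Definition eval_tuple (R : realType) (T Omega : Type) (X : T -> Omega -> R)
    (k : nat) (t : k.-tuple T) (w : Omega) : k.-tuple R :=
  [tuple X (tnth t i) w | i < k].

(* Equality of all the finite-dimensional distributions; the two processes may
   live on different probability spaces. *)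
Definition same_law (R : realType) (T : Type)
    (d d' : measure_display) (Omega : measurableType d)
    (Omega' : measurableType d') (P : probability Omega R)
    (P' : probability Omega' R) (X : T -> Omega -> R) (X' : T -> Omega' -> R) :
    Prop :=
  forall (k : nat) (t : k.-tuple T) (B : set (k.-tuple R)), measurable B ->
    P (eval_tuple X t @^-1` B) = P' (eval_tuple X' t @^-1` B).

Definition process_sigma (R : realType) (T Omega : Type)
    (X : T -> Omega -> R) : set_system Omega :=
  <<s [set E | exists (t : T) (B : set R), measurable B /\ E = X t @^-1` B] >>.

Definition independent_processes (R : realType) (T : Type)
    (d : measure_display) (Omega : measurableType d) (P : probability Omega R)
    (n : nat) (X : 'I_n -> T -> Omega -> R) : Prop :=
  forall E : 'I_n -> set Omega, (forall i, process_sigma (X i) (E i)) ->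
    P (\bigcap_(i in [set: 'I_n]) E i) = (\prod_(i < n) P (E i))%E.

(* The number of copies is n.+1, so the pointwise maximum is over a nonempty
   family; seeding it with the copy of index 0 does not change its value. *)
Definition pointwise_max (R : realType) (T Omega : Type) (n : nat)
    (X : 'I_n.+1 -> T -> Omega -> R) (t : T) (w : Omega) : R :=
  \big[Num.max/X ord0 t w]_(i < n.+1) X i t w.

(* The independent copies may live on any probability space. *)
Definition simple_max_stable (R : realType) (T : Type)
    (d : measure_display) (Omega : measurableType d) (P : probability Omega R)
    (X : T -> {RV P >-> R}) : Prop :=
  (forall (t : T) (x : R), 0 < x ->
     P [set w | X t w <= x] = (expR (- x^-1))%:E) /\
  (forall (n : nat) (d' : measure_display) (Omega' : measurableType d')
     (P' : probability Omega' R) (Y : 'I_n.+1 -> T -> {RV P' >-> R}),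
     (forall i, same_law P' P (fun t w => Y i t w) (fun t w => X t w)) ->
     independent_processes P' (fun i t w => Y i t w) ->
     same_law P' P (pointwise_max (fun i t w => Y i t w))
       (fun t w => n.+1%:R * X t w)).

(* The maximum over A is taken in \bar R, where the neutral element is -oo. *)
Definition is_ecf (R : realType) (T : choiceType)
    (d : measure_display) (Omega : measurableType d) (P : probability Omega R)
    (X : T -> {RV P >-> R}) (theta : {fset T} -> R) : Prop :=
  [/\ forall A : {fset T}, 0 <= theta A,
      theta fset0 = 0 &
      forall (A : {fset T}) (x : R), A != fset0 -> 0 < x ->
        theta A = - x * ln (fine (P [set w |
          (\big[maxe/-oo]_(t <- A) (X t w)%:E <= x%:E)%E]))].

(* A function on [0, +oo[ is represented by a function on R whose values on
   the negative reals play no role. *)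
Definition bernstein (R : realType) (g : R -> R) : Prop :=
  [/\ forall r : R, 0 <= r -> 0 <= g r,
      {within `[0, +oo[, continuous g},
      forall (n : nat) (r : R), 0 < r -> derivable (g^`(n))%classic r 1 &
      forall (n : nat) (r : R), 0 < r -> 0 <= (-1) ^+ n * (g^`(n.+1))%classic r].

(* Main.v *)
Require Import Defs.
From HB Require Import structures.
From mathcomp Require Import all_boot all_order all_algebra finmap.
From mathcomp Require Import all_classical all_reals all_analysis.
From mathcomp Require Import ring lra.

Set Implicit Arguments.
Unset Strict Implicit.
Unset Printing Implicit Defensive.

Import Order.TTheory GRing.Theory Num.Theory.
Import numFieldNormedType.Exports.

Local Open Scope fset_scope.
Local Open Scope ring_scope.

(* Concavity of a nondecreasing g turns a <= c, a <= d and a + b <= c + d into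
   g a + g b <= g c + g d, so the claim follows once theta is monotone and
   theta C + theta (A U B) <= theta (A U C) + theta (C U B). Both come from
   P (max_A X <= x) = exp (- theta A / x): inclusion-exclusion for the events
   {max <= x} over A U C and C U B gives the submodularity of
   1 - exp (- s theta) for every s > 0, and dividing by s -> 0 that of theta. *)

(** * Monotonicity and concavity of Bernstein functions *)

Section bernstein.
Variables (R : realType) (g : R -> R).
Hypothesis hg : bernstein g.

Lemma bernstein_nondecreasing (r s : R) : 0 <= r -> r <= s -> g r <= g s.
Proof.
have [_ cg dg sg] := hg.
apply: ger0_derive1_ndecry => // x; rewrite in_itv/= andbT => x0.
- exact: (dg 0%N).
- by have := sg 0%N x x0; rewrite expr0 mul1r derive1n1.
Qed.

Lemma bernstein_derive1_nonincreasing (r s : R) :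
  0 < r -> r <= s -> (g^`())%classic s <= (g^`())%classic r.
Proof.
have [_ cg dg sg] := hg.
move=> r0; apply: ler0_derive1_nincry (lexx r) => [x|x|].
- rewrite in_itv/= andbT => rx.
  by have := dg 1%N x (lt_trans r0 rx); rewrite derive1n1.
- rewrite in_itv/= andbT => rx.
  have := sg 1%N x (lt_trans r0 rx).
  by rewrite expr1 mulN1r oppr_ge0 derive1nS derive1n1.
- apply: derivable_within_continuous => x; rewrite in_itv/= andbT => rx.
  by have := dg 1%N x (lt_le_trans r0 rx); rewrite derive1n1.
Qed.

(** Differentiability is only known on the open half-line; continuity of [g] at 0 is what admits
    [r = 0]. *)
Lemma bernstein_mean_value (r s : R) : 0 <= r -> r < s ->
  exists2 x, r < x < s & g s - g r = (g^`())%classic x * (s - r).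
Proof.
have [_ cg dg _] := hg.
move=> r0 rs; have [x||x] := @MVT R g (g^`())%classic r s rs.
- rewrite in_itv/= => /andP[rx _].
  have /(_ x (le_lt_trans r0 rx)) := dg 0%N; rewrite derive1n0 => dx.
  by apply: DeriveDef => //; rewrite derive1E.
- apply: continuous_subspaceW cg => x /=; rewrite !in_itv/= andbT.
  by move=> /andP[rx _]; exact: le_trans rx.
- by rewrite in_itv/= => rxs e; exists x.
Qed.

(** Concavity as shrinking increments: the mean value points satisfy [x < u + h <= v < y], and the
    derivative is nonincreasing. *)
Lemma bernstein_increment (u v h : R) : 0 <= u -> u + h <= v -> 0 <= h ->
  g (v + h) - g v <= g (u + h) - g u.
Proof.
move=> u0 uhv; rewrite le_eqVlt => /predU1P[<-|h0].
  by rewrite !addr0 !subrr.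
have [x /andP[ux xu] ->] : exists2 x, u < x < u + h &
    g (u + h) - g u = (g^`())%classic x * (u + h - u).
  by apply: bernstein_mean_value => //; rewrite ltrDl.
have [y /andP[vy _] ->] : exists2 y, v < y < v + h &
    g (v + h) - g v = (g^`())%classic y * (v + h - v).
  by apply: bernstein_mean_value; [lra|rewrite ltrDl].
rewrite ![_ + h - _]addrAC !subrr !add0r ler_pM2r//.
by apply: bernstein_derive1_nonincreasing; lra.
Qed.

Lemma bernstein_four_point (a b c d : R) : 0 <= a -> 0 <= b ->
  a <= c -> a <= d -> a + b <= c + d -> g a + g b <= g c + g d.
Proof.
move=> a0 b0; wlog cd : c d / c <= d.
  move=> H ac ad; have [/H|/ltW /H] := leP c d; first exact.
  by rewrite [c + d]addrC [g c + g d]addrC; exact.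
move=> ac ad abcd.
(* Raise [b] to [d + (c - a)]; it then remains to compare the increments of length [c - a] from [d]
   and from [a], where [c <= d] keeps the intervals disjoint up to endpoints. *)
have gb : g b <= g (d + (c - a)) by apply: bernstein_nondecreasing => //; lra.
have := @bernstein_increment a d (c - a) a0.
have -> : a + (c - a) = c by ring.
by move=> /(_ cd) H; have := H ltac:(lra); lra.
Qed.

End bernstein.

(** Follows from [1 + y <= expR y] and [(1 - y + y ^+ 2) * (1 + y) = 1 + y ^+ 3 >= 1]. *)
Lemma expRN_le_quadratic (R : realType) (y : R) :
  0 <= y -> expR (- y) <= 1 - y + y ^+ 2.
Proof.
move=> y0; rewrite expRN -div1r ler_pdivrMr ?expR_gt0//.
have y2 : 0 <= 1 - y + y ^+ 2 by nra.
apply: le_trans (ler_wpM2l y2 (expR_ge1Dx y)).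
have -> : (1 - y + y ^+ 2) * (1 + y) = 1 + y ^+ 3 by ring.
by rewrite lerDl exprn_ge0.
Qed.

(** * Distribution functions of finite maxima *)

Section ecf.
Variables (R : realType) (T : choiceType).
Variables (d : measure_display) (Omega : measurableType d).
Variables (P : probability Omega R) (X : T -> {RV P >-> R}).

(** The event that the maximum over [s] is at most [x]. Lists allow induction and concatenation, and
    the empty list gives the sure event. *)
Definition all_le (x : R) (s : seq T) : set Omega :=
  [set w | all (fun t => X t w <= x) s].

Lemma bigmaxe_le_all (f : T -> R) (x : R) (s : seq T) :
  (\big[maxe/-oo]_(t <- s) (f t)%:E <= x%:E)%E = all (fun t => f t <= x) s.
Proof.
elim: s => [|t s IH]; first by rewrite big_nil leNye.
by rewrite big_cons ge_max lee_fin IH.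
Qed.

Lemma measurable_all_le (x : R) (s : seq T) : measurable (all_le x s).
Proof.
elim: s => [|t s IH]; first by rewrite (_ : all_le _ _ = setT)//; apply/seteqP.
rewrite (_ : all_le x _ = (X t @^-1` `]-oo, x] `&` all_le x s)%classic).
  apply: measurableI => //; rewrite -[X in measurable X]setTI.
  exact: measurable_funP.
by apply/seteqP; split=> w /=; rewrite in_itv/=; [move=> /andP|move=> /andP].
Qed.

Definition max_cdf (x : R) (s : seq T) : R := fine (P (all_le x s)).

Lemma max_cdfE (x : R) (s : seq T) : P (all_le x s) = (max_cdf x s)%:E.
Proof.
by rewrite /max_cdf fineK// fin_num_measure//; exact: measurable_all_le.
Qed.

Lemma max_cdf_le (x : R) (s s' : seq T) : 
  {subset s <= s'} -> max_cdf x s' <= max_cdf x s.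
Proof.
move=> ss'; rewrite -lee_fin -!max_cdfE le_measure ?inE//;
  try exact: measurable_all_le.
by move=> w /allP h; apply/allP => t /ss'; exact: h.
Qed.

Hypothesis hX : simple_max_stable X.

Lemma max_cdf1 (x : R) (t : T) : 0 < x -> max_cdf x [:: t] = expR (- x^-1).
Proof.
move=> x0; have [h _] := hX.
rewrite /max_cdf (_ : all_le x _ = [set w | X t w <= x]%classic) ?h//.
by apply/seteqP; split=> w; rewrite /all_le/= andbT.
Qed.

(** Inclusion-exclusion: the two events on the left intersect in the event of [a ++ c ++ b], and
    their union lies in the event of [c]. *)
Lemma max_cdf_modular (x : R) (a b c : seq T) :
  max_cdf x (a ++ c) + max_cdf x (c ++ b) <=
  max_cdf x c + max_cdf x (a ++ c ++ b).
Proof.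
have EU : all_le x (a ++ c ++ b) =
    (all_le x (a ++ c) `&` all_le x (c ++ b))%classic.
  apply/seteqP; split=> w; rewrite /all_le/= !all_cat.
    by move=> /and3P[-> -> ->].
  by move=> [/andP[-> ->] /andP[_ ->]].
rewrite -lee_fin !EFinD -!max_cdfE.
have mac := measurable_all_le x (a ++ c).
have mcb := measurable_all_le x (c ++ b).
have -> : (P (all_le x (a ++ c)) + P (all_le x (c ++ b)) =
    P (all_le x (a ++ c) `|` all_le x (c ++ b))%classic +
    P (all_le x (a ++ c ++ b)))%E.
  rewrite EU (measureUfinr mac mcb); last first.
    by rewrite -ge0_fin_numE ?fin_num_measure.
  by rewrite subeK// fin_num_measure//; exact: measurableI.
apply: leeD => //; apply: le_measure; rewrite ?inE//.
- exact: measurableU.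
- exact: measurable_all_le.
by move=> w []; rewrite /all_le/= all_cat => /andP[].
Qed.

(** Union bound, since each margin exceeds [x] with probability [1 - expR (- x^-1) <= x^-1]. It
    makes the probability positive for large [x]. *)
Lemma max_cdf_ge (x : R) (s : seq T) : 
  0 < x -> 1 - (size s)%:R / x <= max_cdf x s.
Proof.
move=> x0; elim: s => [|t s IH].
  rewrite mul0r subr0 /max_cdf (_ : all_le x _ = setT) ?probability_setT//.
  by apply/seteqP.
(* With an empty overlap, modularity is the Bonferroni inequality. *)
have := max_cdf_modular x [:: t] s [::]; rewrite /= max_cdf1//.
have -> : max_cdf x [::] = 1.
  by rewrite /max_cdf (_ : all_le x _ = setT) ?probability_setT//; apply/seteqP.
have := expR_ge1Dx (- x^-1).
move: IH; rewrite /= -natr1 mulrDl mul1r.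
by lra.
Qed.

(** * Bounds, monotonicity and submodularity of the extremal coefficient function *)

Variable theta : {fset T} -> R.
Hypothesis htheta : is_ecf X theta.

Lemma ecfE (A : {fset T}) (x : R) : A != fset0 -> 0 < x ->
  theta A = - x * ln (max_cdf x A).
Proof.
move=> A0 x0; have [_ _ /(_ A x A0 x0) ->] := htheta.
congr (_ * ln (fine (P _))).
by apply/seteqP; split=> w /=; rewrite bigmaxe_le_all.
Qed.

Lemma ecf_ge1 (A : {fset T}) : A != fset0 -> 1 <= theta A.
Proof.
move=> A0; have [t tA] := fset0Pn _ A0.
(* Any [x] above the size of [A] makes the union bound positive, so that [ln] is monotone at the
   values compared. *)
pose x : R := (size A).+1%:R; have x0 : 0 < x by rewrite ltr0n.
have F0 : 0 < max_cdf x A.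
  apply: lt_le_trans (max_cdf_ge A x0).
  by rewrite subr_gt0 ltr_pdivrMr// mul1r ltr_nat.
have Ft : max_cdf x A <= expR (- x^-1).
  by rewrite -(max_cdf1 t x0); apply: max_cdf_le => u; rewrite inE => /eqP ->.
rewrite (ecfE A0 x0) mulNr -mulrN -ler_pdivrMl// mulr1 lerNr.
by rewrite -[leRHS]expRK ler_ln ?posrE ?expR_gt0.
Qed.

(* As ln 0 = 0 here, a vanishing probability would give [theta A = 0]; this is
   excluded by [1 <= theta A]. *)
Lemma ecf_cdf (A : {fset T}) (x : R) : A != fset0 -> 0 < x ->
  max_cdf x A = expR (- (x^-1 * theta A)).
Proof.
move=> A0 x0; have tA := ecf_ge1 A0; have tE := ecfE A0 x0.
have F0 : 0 < max_cdf x A.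
  rewrite ltNge; apply/negP => /ln0 FA.
  by move: tA; rewrite tE FA mulr0 ler10.
by rewrite tE mulNr mulrN opprK mulKf ?gt_eqF// lnK.
Qed.

Lemma ecf_le (A B : {fset T}) : A != fset0 -> A `<=` B -> theta A <= theta B.
Proof.
move=> A0 AB.
have B0 : B != fset0 by apply: contraNneq A0 => B0; rewrite -fsubset0 -B0.
have := @max_cdf_le 1 A B (fsubsetP AB).
by rewrite !ecf_cdf// invr1 !mul1r ler_expR lerN2.
Qed.

Lemma ecf_submodular (A B C : {fset T}) : C != fset0 ->
  theta C + theta (A `|` C `|` B) <= theta (A `|` C) + theta (C `|` B).
Proof.
move=> C0.
have sup (U V : {fset T}) : C `<=` V -> V != fset0.
  by move=> CV; apply: contraNneq C0 => V0; rewrite -fsubset0 -V0.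
have AC0 : A `|` C != fset0 by apply: sup => //; exact: fsubsetUr.
have CB0 : C `|` B != fset0 by apply: sup => //; exact: fsubsetUl.
have ACB0 : A `|` C `|` B != fset0.
  by apply: sup => //; rewrite -fsetUA fsetUCA; exact: fsubsetUl.
(* Order and repetitions in a list do not matter, so concatenations may be replaced by unions. *)
have Feq x (U : {fset T}) s : U =i s -> max_cdf x s = max_cdf x U.
  by move=> Us; apply/le_anti/andP; split; apply: max_cdf_le => t; rewrite Us.
set u := theta C; set v := theta (A `|` C `|` B).
set p := theta (A `|` C); set q := theta (C `|` B).
have u0 : 1 <= u := ecf_ge1 C0.
have v0 : 1 <= v := ecf_ge1 ACB0.
pose K := u ^+ 2 + v ^+ 2.
(* Modularity at level [s^-1], with the exponentials of [p] and [q] bounded below to first order and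
   those of [u] and [v] above to second order, then divided by [s]. *)
have key s : 0 < s -> u + v <= p + q + s * K.
  move=> s0; have x0 : 0 < s^-1 by rewrite invr_gt0.
  have := max_cdf_modular s^-1 A B C.
  rewrite (Feq _ (A `|` C) (A ++ C)); last by move=> t; rewrite !inE mem_cat.
  rewrite (Feq _ (C `|` B) (C ++ B)); last by move=> t; rewrite !inE mem_cat.
  rewrite (Feq _ (A `|` C `|` B) (A ++ C ++ B)); last first.
    by move=> t; rewrite !inE !mem_cat orbA.
  rewrite !ecf_cdf// invrK -/u -/v -/p -/q.
  have := expR_ge1Dx (- (s * p)); have := expR_ge1Dx (- (s * q)).
  have := @expRN_le_quadratic R (s * u) ltac:(nra).
  have := @expRN_le_quadratic R (s * v) ltac:(nra).
  move=> hv hu hq hp h.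
  rewrite -(ler_pM2l s0) mulrDr.
  have -> : s * (p + q + s * K) = s * p + s * q + (s * u) ^+ 2 + (s * v) ^+ 2.
    by rewrite /K; ring.
  by lra.
rewrite leNgt; apply/negP => lt.
have K0 : 0 < K by rewrite /K; nra.
(* This replaces the limit [s -> 0]: for this [s] the error [s * K] is half the supposed positive
   excess, which would be at most its own half. *)
have := key ((u + v - (p + q)) / (2 * K)).
rewrite divr_gt0 ?mulr_gt0 ?subr_gt0// => /(_ isT).
have -> : (u + v - (p + q)) / (2 * K) * K = (u + v - (p + q)) / 2.
  by field; rewrite gt_eqF.
by lra.
Qed.

End ecf.

Theorem corollary21 (R : realType) (T : choiceType)
    (d : measure_display) (Omega : measurableType d) (P : probability Omega R)
    (X : T -> {RV P >-> R}) (hX : simple_max_stable X)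
    (theta : {fset T} -> R) (htheta : is_ecf X theta)
    (g : R -> R) (hg : bernstein g)
    (A B C : {fset T}) (hA : A != fset0) (hB : B != fset0) (hC : C != fset0) :
  let eta := fun D : {fset T} => theta D - 1 in
  g (eta (A `|` B)) <= g (eta C) + g (eta (A `|` B)) /\
  g (eta C) + g (eta (A `|` B)) <= g (eta (A `|` C)) + g (eta (C `|` B)).
Proof.
move=> eta; have [g0 _ _ _] := hg.
have eta0 (D : {fset T}) : D != fset0 -> 0 <= eta D.
  by move=> D0; rewrite subr_ge0; exact: (ecf_ge1 hX htheta).
split; first by rewrite lerDr; exact/g0/eta0.
have AB0 : A `|` B != fset0.
  by apply: contraNneq hA => AB0; rewrite -fsubset0 -AB0 fsubsetUl.
have leAC := ecf_le hX htheta hC (fsubsetUr A C).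
have leCB := ecf_le hX htheta hC (fsubsetUl C B).
(* Submodularity bounds the union that includes [C]; monotonicity drops [C] from it. *)
have leAB : theta (A `|` B) <= theta (A `|` C `|` B).
  by apply: (ecf_le hX htheta) => //; rewrite fsetUAC fsubsetUl.
have sub := ecf_submodular hX htheta A B hC.
by apply: bernstein_four_point; rewrite ?eta0// /eta; lra.
Qed.
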